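(* For a convex cone $E_+$ in a real topological vector space $E$, the following are equivalent: (i) $E_+$ is weakly closed and semisimple; (ii) $E_+$ is a weakly closed proper cone; (iii) There is a weaker locally convex topology on $E$ for which $E_+$ is closed and normal; (iv) There is a topological space $\Omega$ and an injective bipositive representation $E \to C_p(\Omega)$; (v) There is a locally compact Hausdorff space $\Omega$ and an injective bipositive representation $E \to C_k(\Omega)$. Furthermore, if $E$ is a normed space, then (when these equivalent conditions hold) the topology in (iii) can be taken normable, and the space $\Omega$ in (v) can be taken compact.
   Context: All vector spaces are real and all topological vector spaces (including locally convex spaces) are Hausdorff; ''weaker'' means coarser, not necessarily strictly. A convex cone is a non-empty subset $\mathcal{K}$ with $\mathcal{K}+\mathcal{K}\subseteq\mathcal{K}$ and $\lambda\mathcal{K}\subseteq\mathcal{K}$ for all $\lambda\ge0$; it is proper if $\mathcal{K}\cap-\mathcal{K}=\{0\}$. $E$ is preordered by $x\le y\iff y-x\in E_+$. $E'$ is the topological dual, and $E'_+$ is the set of continuous linear functionals that are non-negative on $E_+$. The cone $E_+$ is (topologically) semisimple if $E'_+$ separates points on $E$, i.e. for every $x\ne0$ there is $\varphi\in E'_+$ with $\varphi(x)\neq0$. Weakly closed means closed for $\sigma(E,E')$. The cone $E_+$ is normal for a locally convex topology if this topology has a base of $0$-neighbourhoods $U$ that are full (i.e. $x\le y\le z$ with $x,z\in U$ implies $y\in U$); equivalently, the topology is generated by a family of seminorms $\rho$ that are monotone ($0\le x\le y$ implies $\rho(x)\le\rho(y)$). $C_p(\Omega)$ and $C_k(\Omega)$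 denote the space $C(\Omega)$ of continuous functions $\Omega\to\mathbb{R}$ with the topology of pointwise convergence, respectively of compact convergence (uniform convergence on compact subsets), with the cone of everywhere non-negative functions. A representation is a continuous linear map from $E$ to such a space. A linear map $T:E\to F$ is bipositive if $E_+=T^{-1}[F_+]$. *)

(* Defs.v *)
From HB Require Import structures.
From mathcomp Require Import all_boot all_order all_algebra.
From mathcomp Require Import all_classical all_reals all_analysis.

Set Implicit Arguments.
Unset Strict Implicit.
Unset Printing Implicit Defensive.

Import Order.TTheory GRing.Theory Num.Theory.
Import numFieldNormedType.Exports.

Local Open Scope classical_set_scope.
Local Open Scope ring_scope.

Section Cones.
Context {R : realType} {E : lmodType R}.
Implicit Types K U : set E.

Definition convex_cone K : Prop :=
  [/\ K !=set0,
      forall x y, K x -> K y -> K (x + y)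
    & forall (a : R) x, 0 <= a -> K x -> K (a *: x)].

Definition proper_cone K : Prop := K `&` [set x | K (- x)] = [set 0].

Definition cone_le K (x y : E) : Prop := K (y - x).

Definition full_set K U : Prop :=
  forall x y z, U x -> U z -> cone_le K x y -> cone_le K y z -> U y.

End Cones.

(* A topology on the (fixed) vector space E is an inhabitant of [Topological E];
   [Topological.Pack] turns it into a topologicalType with carrier E. *)
Section TopologiesOnVectorSpace.
Context {R : realType} {E : lmodType R}.
Implicit Types (S T : Topological E) (K : set E).

Definition weaker_topology S T : Prop :=
  @open (Topological.Pack S) `<=` @open (Topological.Pack T).

(* Hausdorffness is part of the convention for locally convex spaces. *)
Definition locally_convex_topology T : Prop :=
  let F := Topological.Pack T in
  [/\ hausdorff_space F,
      continuous ((fun z => (z.1 : E) + (z.2 : E)) : F * F -> F),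
      continuous ((fun z => z.1 *: (z.2 : E)) : R * F -> F)
    & exists2 B : set (set E), B `<=` @convex_set R E & @basis F B].

Definition closed_for T K : Prop := @closed (Topological.Pack T) K.

Definition normal_for T K : Prop :=
  forall U : set E, @nbhs _ (Topological.Pack T) (0 : E) U ->
  exists V : set E, [/\ @nbhs _ (Topological.Pack T) (0 : E) V,
    V `<=` U & full_set K V].

Definition is_norm (N : E -> R) : Prop :=
  [/\ forall x, N x = 0 -> x = 0,
      forall x y, N (x + y) <= N x + N y
    & forall (a : R) x, N (a *: x) = `|a| * N x].

Definition normable_topology T : Prop :=
  exists2 N : E -> R, is_norm N &
    forall (x : E) (U : set E), @nbhs _ (Topological.Pack T) x U <->
      exists2 e : R, 0 < e & [set y | N (y - x) < e] `<=` U.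

End TopologiesOnVectorSpace.

Section Dual.
Context {R : realType} (E : topologicalLmodType R).

Definition dual := {phi : {scalar E} | continuous phi}.

Definition dual_cone (K : set E) : set dual :=
  [set phi : dual | forall x, K x -> 0 <= sval phi x].

Definition semisimple_cone (K : set E) : Prop :=
  forall x : E, x != 0 -> exists2 phi, dual_cone K phi & sval phi x != 0.

(* sigma(E, E'), on the carrier of E: the coarsest topology for which all
   elements of the dual are continuous. It need not be Hausdorff. *)
Definition weak_topology : topologicalType :=
  sup_topology (fun phi : dual => Topological.class (initial_topology (sval phi))).

Definition weakly_closed (K : set E) : Prop := closed (K : set weak_topology).

End Dual.

Section ContinuousFunctions.
Context (Omega : topologicalType) (R : realType).
Local Notation C := (continuousType Omega R).
Implicit Types f g h : C.

Let zero_cts : continuous (fun _ : Omega => 0 : R).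
Proof. by move=> x; exact: cvg_cst. Qed.

Let opp_cts f : continuous (fun x => - f x).
Proof. by move=> x; apply: cvgN; exact: cts_fun. Qed.

Let add_cts f g : continuous (fun x => f x + g x).
Proof. by move=> x; apply: cvgD; exact: cts_fun. Qed.

Let scale_cts (a : R) f : continuous (fun x => a * f x).
Proof. by move=> x; apply: cvgM; [exact: cvg_cst|exact: cts_fun]. Qed.

Definition cts_zero : C := mkcts zero_cts.
Definition cts_opp f : C := mkcts (@opp_cts f).
Definition cts_add f g : C := mkcts (@add_cts f g).
Definition cts_scale (a : R) f : C := mkcts (@scale_cts a f).

Let addA : associative cts_add.
Proof. by move=> f g h; apply/continuousEP => x; exact: addrA. Qed.
Let addC : commutative cts_add.
Proof. by move=> f g; apply/continuousEP => x; exact: addrC. Qed.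
Let add0 : left_id cts_zero cts_add.
Proof. by move=> f; apply/continuousEP => x; exact: add0r. Qed.
Let addN : left_inverse cts_zero cts_opp cts_add.
Proof. by move=> f; apply/continuousEP => x; exact: addNr. Qed.

HB.instance Definition _ :=
  GRing.isZmodule.Build (continuousType Omega R) addA addC add0 addN.

Let scaleA a b f : cts_scale a (cts_scale b f) = cts_scale (a * b) f.
Proof. by apply/continuousEP => x; exact: mulrA. Qed.
Let scale1 : left_id 1 cts_scale.
Proof. by move=> f; apply/continuousEP => x; exact: mul1r. Qed.
Let scaleDr : right_distributive cts_scale +%R.
Proof. by move=> a f g; apply/continuousEP => x; exact: mulrDr. Qed.
Let scaleDl f : {morph cts_scale^~ f : a b / a + b}.
Proof. by move=> a b; apply/continuousEP => x; exact: mulrDl. Qed.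

HB.instance Definition _ :=
  GRing.Zmodule_isLmodule.Build R (continuousType Omega R)
    scaleA scale1 scaleDr scaleDl.

(* C(Omega) with its pointwise vector space structure, and the topology induced
   by that of pointwise, respectively compact, convergence on Omega -> R. *)
Definition Cp : Type := C.
Definition Ck : Type := C.

HB.instance Definition _ := GRing.Lmodule.copy Cp C.
HB.instance Definition _ := Topological.copy Cp
  (initial_topology (fun f : C => (f : Omega -> R) : {ptws Omega -> R})).

HB.instance Definition _ := GRing.Lmodule.copy Ck C.
HB.instance Definition _ := Topological.copy Ck
  (initial_topology
    (fun f : C => (f : Omega -> R) : {family compact, Omega -> R})).

Definition Cnonneg : set C := [set f | forall x, 0 <= f x].

End ContinuousFunctions.

Section Representations.
Context {R : realType}.

Definition bipositive (E F : Type) (KE : set E) (KF : set F) (T : E -> F) : Prop :=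
  KE = T @^-1` KF.

Definition weaker_normal_topology (E : topologicalLmodType R) (K : set E)
    (T : Topological E) : Prop :=
  [/\ weaker_topology T (Topological.class E), locally_convex_topology T,
      closed_for T K & normal_for T K].

Definition has_Cp_representation (E : topologicalLmodType R) (K : set E)
    (Omega : topologicalType) : Prop :=
  exists T : {linear E -> Cp Omega R},
    [/\ continuous T, injective T & bipositive K (@Cnonneg Omega R) T].

Definition has_Ck_representation (E : topologicalLmodType R) (K : set E)
    (Omega : topologicalType) : Prop :=
  exists T : {linear E -> Ck Omega R},
    [/\ continuous T, injective T & bipositive K (@Cnonneg Omega R) T].

End Representations.

(* Main.v *)
From HB Require Import structures.
Require Import Defs.
From mathcomp Require Import all_boot all_order all_algebra.
From mathcomp Require Import all_classical all_reals all_analysis.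
From mathcomp Require Import ring lra.

Import Order.TTheory GRing.Theory Num.Theory.
Import numFieldNormedType.Exports.

Local Open Scope classical_set_scope.
Local Open Scope ring_scope.

(** All five conditions say the same thing about the cone of positive
continuous functionals: it determines [K], in the sense that [x] belongs to
[K] as soon as every positive functional is non-negative at [x]
([dually_determined]), and it separates points ([semisimple_cone]).

Each condition implies this. Let [x] lie outside [K]. If a convex open set
contains [x] and misses [K], then the gauge of [V - K], where [V] is that set
translated by [-x], is a sublinear functional that vanishes on [-K], is at
most 1 on [V] and at least 1 at [-x]; a linear functional which it dominates and
which agrees with it at [-x] (Hahn-Banach) is non-negative on [K], negative
at [x], and continuous ([open_separation]). Such a convex open set exists when
[K] is closed in a weaker locally convex topology by definition, and when [K]
is weakly closed because weak neighbourhoods contain convex ones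
([weak_nbhs_convex]). If moreover [K] is proper, then [x] and [-x] are not
both in [K] for [x != 0], so some positive functional does not vanish at [x].
Normality in a Hausdorff topology forces [K] to be proper, because
[0 <= x <= 0] puts [x] in every full neighbourhood of [0]. For a
representation on [Omega], the evaluations at the points of [Omega] provide
enough positive functionals.

Conversely, when the positive functionals determine [K] and separate points,
the topology defined by the seminorms [x |-> `|phi x|], with [phi] positive,
is locally convex and weaker, and its balls are full because [`|phi y|] is
at most the maximum of [`|phi x|] and [`|phi z|] when [x <= y <= z]
([weak_normal_topology]). The evaluation map represents [E] on the set of
positive functionals; with the discrete topology on this set compact sets are
finite, so that compact and pointwise convergence coincide
([discrete_representation]).

If [E] is normed, the positive functionals of norm at most 1 suffice, since
every positive functional is a multiple of one of them. They form a compact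
space for pointwise convergence (Alaoglu), on which the evaluation map is
contractive ([compact_representation]), and the supremum over this ball of
[`|f x|] is a norm whose balls are full ([normable_normal_topology]). *)

Set Implicit Arguments.
Unset Strict Implicit.
Unset Printing Implicit Defensive.

(** * Preliminaries *)

Section RealNumbers.
Context {R : realType}.
Implicit Types a b c s t e : R.

Lemma ltr_convex_combination s t a b e : 0 <= s -> 0 <= t -> s + t = 1 ->
  a < e -> b < e -> s * a + t * b < e.
Proof.
move=> s0 t0 st ae be.
have mx : Num.max a b < e by rewrite gt_max ae be.
apply: le_lt_trans mx; rewrite -[leRHS]mul1r -st mulrDl.
by apply: lerD; apply: ler_wpM2l => //; rewrite le_max lexx ?orbT.
Qed.

Lemma ler_norm_between a b c : a <= b -> b <= c -> `|b| <= Num.max `|a| `|c|.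
Proof.
move=> ab bc; rewrite le_max; apply/orP.
have [b0|b0] := leP 0 b; [right|left].
  by rewrite !ger0_norm//; lra.
by rewrite !ltr0_norm//; lra.
Qed.

End RealNumbers.

Definition scalar_of {R : realType} {E : lmodType R} (f : E -> R)
    (lf : linear_for *%R f) : {scalar E} :=
  let lf' := GRing.isLinear.Build R E R *%R f lf in
  HB.pack_for {scalar E} f lf'.

(** * The Hahn-Banach theorem *)

Section HahnBanach.
Context {R : realType} {E : lmodType R}.
Implicit Types (p q : E -> R) (x y z : E).

(** The inequality for [a^-1] gives the reverse of the one for [a], so that this
is positive homogeneity; [a = 0] gives [p 0 <= 0], which subadditivity turns
into [p 0 = 0]. *)
Definition sublinear p : Prop :=
  (forall x y, p (x + y) <= p x + p y) /\
  (forall (a : R) x, 0 <= a -> p (a *: x) <= a * p x).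

Lemma sublinear0 p : sublinear p -> p 0 = 0.
Proof.
move=> [pD pZ]; apply/le_anti/andP; split.
  by have := pZ 0 0 (lexx _); rewrite scale0r mul0r.
by have := pD 0 0; rewrite addr0; lra.
Qed.

Lemma sublinearZ p (a : R) x : sublinear p -> 0 <= a -> p (a *: x) = a * p x.
Proof.
move=> sp; rewrite le_eqVlt => /predU1P[<-|a0].
  by rewrite scale0r mul0r sublinear0.
case: (sp) => _ pZ; apply/le_anti/andP; split; first exact/pZ/ltW.
have := pZ a^-1 (a *: x); rewrite invr_ge0 ltW// => /(_ isT).
by rewrite scalerA mulVf ?gt_eqF// scale1r -ler_pdivrMl ?invr_gt0// invrK.
Qed.

(** If the [S x] are the fibres of a convex cone in [E * R], up to enlarging the
real component, then their lower boundary is sublinear. Gauges, infima of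
chains and the functionals [shift_sublinear] all arise in this way. *)
Lemma sublinear_inf (S : E -> set R) :
  (forall x, S x !=set0) -> (forall x, has_lbound (S x)) ->
  (forall x y s t, S x s -> S y t -> exists2 u, S (x + y) u & u <= s + t) ->
  (forall (a : R) x s, 0 <= a -> S x s -> exists2 u, S (a *: x) u & u <= a * s) ->
  sublinear (fun x => inf (S x)).
Proof.
move=> S0 Sb SD SZ; split => [x y|a x a0].
  rewrite -lerBlDl; apply: lb_le_inf => // t yt.
  rewrite lerBlDl -lerBlDr; apply: lb_le_inf => // s xs.
  rewrite lerBlDr; have [u xyu ule] := SD _ _ _ _ xs yt.
  exact: le_trans (ge_inf (Sb _) xyu) ule.
have le s : S x s -> inf (S (a *: x)) <= a * s.
  move=> xs; have [u axu ule] := SZ a x s a0 xs.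
  exact: le_trans (ge_inf (Sb _) axu) ule.
move: a0; rewrite le_eqVlt => /predU1P[a0|a0].
  by have [s xs] := S0 x; have := le _ xs; rewrite -a0 !mul0r.
rewrite -ler_pdivrMl//; apply: lb_le_inf => // s /le.
by rewrite ler_pdivrMl.
Qed.

(** A sublinear functional below [p] whose value at [- z] is at most [- p z].
It serves twice: a minimal [p] must coincide with it, hence is odd; and any
linear functional below it agrees with [p] at [z]. *)
Definition shift_sublinear p z x : R :=
  inf [set p (x + t *: z) - t * p z | t in [set t : R | 0 <= t]].

Let shift_lb p z x : sublinear p ->
  lbound [set p (x + t *: z) - t * p z | t in [set t : R | 0 <= t]] (- p (- x)).
Proof.
move=> sp _ [t /= t0 <-]; case: (sp) => pD _.
by have := pD (x + t *: z) (- x); rewrite addrAC subrr add0r sublinearZ//; lra.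
Qed.

Lemma shift_sublinear_le p z (t : R) x : sublinear p -> 0 <= t ->
  shift_sublinear p z x <= p (x + t *: z) - t * p z.
Proof.
move=> sp t0; apply: ge_inf; last by exists t.
by exists (- p (- x)); exact: shift_lb.
Qed.

Lemma shift_sublinearP p z : sublinear p -> sublinear (shift_sublinear p z).
Proof.
move=> sp; case: (sp) => pD pZ; apply: sublinear_inf => [x|x|x y|a x].
- by exists (p (x + 0 *: z) - 0 * p z), 0 => /=.
- by exists (- p (- x)); exact: shift_lb.
- move=> _ _ [s /= s0 <-] [t /= t0 <-].
  exists (p (x + y + (s + t) *: z) - (s + t) * p z).
    by exists (s + t) => //=; rewrite addr_ge0.
  by have := pD (x + s *: z) (y + t *: z); rewrite addrACA -scalerDl; lra.
- move=> _ a0 [s /= s0 <-].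
  exists (p (a *: x + (a * s) *: z) - (a * s) * p z).
    by exists (a * s) => //=; rewrite mulr_ge0.
  by have := pZ a (x + s *: z) a0; rewrite scalerDr scalerA; lra.
Qed.

(** Zorn's lemma: a chain of sublinear functionals below [p] has an infimum,
because [q x] is bounded below by [- p (- x)] for each [q] in it. *)
Lemma exists_minimal_sublinear p : sublinear p ->
  exists q, [/\ sublinear q, forall x, q x <= p x &
    forall r, sublinear r -> (forall x, r x <= q x) -> r = q].
Proof.
move=> sp.
pose T := {q : E -> R | sublinear q /\ forall x, q x <= p x}.
pose below (s t : T) := `[< forall x, sval t x <= sval s x >].
have [| | | |[q [sq qp]] qmin] := @Zorn T below.
- by move=> t; apply/asboolP.
- move=> r s t /asboolP rs /asboolP st; apply/asboolP => x.
  exact: le_trans (st x) (rs x).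
- move=> [s Ps] [t Pt] /asboolP st /asboolP ts; apply: eq_exist; apply/funext => x.
  by apply/le_anti; rewrite st ts.
- move=> A totA; have [[s0 As0]|A0] := pselect (A !=set0); last first.
    have pp : sublinear p /\ forall x, p x <= p x by [].
    by exists (exist _ p pp) => s As; exfalso; apply: A0; exists s.
  pose S x := [set sval s x | s in A].
  have Slb x : has_lbound (S x).
    exists (- p (- x)) => _ [[s [ss sp']] As <-] /=.
    have := ss.1 x (- x); rewrite subrr sublinear0//.
    by have := sp' (- x); lra.
  have Sinf : sublinear (fun x => inf (S x)).
    apply: sublinear_inf => // [x|x y|a x].
    + by exists (sval s0 x), s0.
    + move=> _ _ [s As <-] [t At <-]; have [/asboolP st|/asboolP ts] := totA _ _ As At.
        exists (sval t (x + y)); first by exists t.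
        by case: (svalP t) => -[tD _] _; apply: le_trans (tD _ _) _; rewrite lerD2r.
      exists (sval s (x + y)); first by exists s.
      by case: (svalP s) => -[sD _] _; apply: le_trans (sD _ _) _; rewrite lerD2l.
    + move=> _ a0 [s As <-]; exists (sval s (a *: x)); first by exists s.
      by case: (svalP s) => -[_ sZ] _; exact: sZ.
  have Sle x s : A s -> inf (S x) <= sval s x by move=> As; apply: ge_inf => //; exists s.
  have Sp x : inf (S x) <= p x by apply: le_trans (Sle _ _ As0) _; exact: (svalP s0).2.
  pose infA : T := exist _ (fun x => inf (S x)) (conj Sinf Sp).
  exists infA => s As; apply/asboolP => x /=; exact: Sle.
exists q; split => // r sr rq.
have Pr : sublinear r /\ forall x, r x <= p x.
  by split => // x; exact: le_trans (rq x) (qp x).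
by have /(congr1 sval) := qmin (exist _ r Pr) (asboolT rq).
Qed.

(** A subadditive odd functional is additive. Oddness comes from minimality
compared with [shift_sublinear q x]. *)
Lemma minimal_sublinear_linear q : sublinear q ->
  (forall r, sublinear r -> (forall x, r x <= q x) -> r = q) ->
  exists f : {scalar E}, f = q :> (E -> R).
Proof.
move=> sq qmin; have [qD _] := sq.
have qN x : q (- x) = - q x.
  apply/le_anti/andP; split; last first.
    by have := qD x (- x); rewrite subrr (sublinear0 sq); lra.
  rewrite -[X in X (- x) <= _](qmin (shift_sublinear q x) (shift_sublinearP x sq)).
    have := shift_sublinear_le x (- x) sq ler01.
    by rewrite scale1r addNr sublinear0// mul1r sub0r.
  move=> y; have := shift_sublinear_le x y sq (lexx _).
  by rewrite scale0r addr0 mul0r subr0.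
have lq : linear_for *%R q.
  move=> a x y; have qZ : q (a *: x) = a * q x.
    have [a0|a0] := leP 0 a; first exact: sublinearZ.
    rewrite -[in LHS](opprK a) scaleNr qN sublinearZ ?oppr_ge0 ?ltW//; ring.
  rewrite -qZ; apply/le_anti; rewrite qD /=.
  by have := qD (- (a *: x)) (- y); rewrite -opprD !qN; lra.
by exists (scalar_of lq).
Qed.

Theorem Hahn_Banach p z : sublinear p ->
  exists2 f : {scalar E}, (forall x, f x <= p x) & f z = p z.
Proof.
move=> sp; have [q [sq qle qmin]] := exists_minimal_sublinear (shift_sublinearP z sp).
have [f fq] := minimal_sublinear_linear sq qmin.
have fp x : f x <= p x.
  rewrite fq (le_trans (qle x))//.
  have := shift_sublinear_le z x sp (lexx _).
  by rewrite scale0r addr0 mul0r subr0.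
exists f => //; apply/le_anti; rewrite fp /=.
have : f (- z) <= - p z.
  rewrite fq (le_trans (qle _))//.
  have := shift_sublinear_le z (- z) sp ler01.
  by rewrite scale1r addNr sublinear0// mul1r sub0r.
by rewrite linearN lerN2.
Qed.

End HahnBanach.

(** * Separation of a cone from a point *)

Section Separation.
Context {R : realType} {E : lmodType R}.
Implicit Types (K U V : set E) (x y : E).

Lemma convex_setP U : @convex_set R E U <->
  forall x y (s t : R), 0 <= s -> 0 <= t -> s + t = 1 -> U x -> U y ->
    U (s *: x + t *: y).
Proof.
have convE (l : {i01 R}) (x y : convex_lmodType E) :
  conv l x y = (l%:num *: (x : E) + (1 - l%:num) *: (y : E)) :> E by [].
split => [cU x y s t s0 t0 st1 Ux Uy|cU x y l].
  have s1 : s <= 1 by rewrite -st1 lerDl.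
  have := cU x y (Itv01 s0 s1) (mem_set Ux) (mem_set Uy).
  rewrite inE convE /=.
  by have -> : t = 1 - s by rewrite -st1; ring.
rewrite !inE convE => Ux Uy; apply: cU => //.
by rewrite addrC subrK.
Qed.

(** Geometric form of Hahn-Banach. The functional is dominated by the gauge
of [V - K]: the gauge vanishes on [- K], is at most 1 on [V], and is at least
1 at [- x] because [- x] is not in [V - K]. The bound on [V] is kept in the
conclusion since it gives continuity. *)
Lemma algebraic_separation K V x : convex_cone K -> @convex_set R E V -> V 0 ->
  (forall y, exists2 t : R, 0 < t & V (t *: y)) ->
  (forall v, V v -> ~ K (x + v)) ->
  exists f : {scalar E}, [/\ f x < 0, forall k, K k -> 0 <= f k &
    forall v, V v -> f v <= 1].
Proof.
move=> [[k0 Kk0] KD KZ] /convex_setP cV V0 absV xVK.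
have K0 : K 0 by rewrite -(scale0r k0); exact: KZ.
(* [inf (S y)] is the gauge of [V - K]; as [K] is a cone, only [V] is scaled. *)
pose S y := [set t : R | 0 <= t /\
  exists v k, [/\ V v, K k & y = t *: v - k]].
have Slb y : lbound (S y) 0 by move=> t [].
have Sinf : sublinear (fun y => inf (S y)).
  apply: sublinear_inf => [y|y|y z s t|a y s].
  - have [t t0 tyV] := absV y; exists t^-1; split; first by rewrite invr_ge0 ltW.
    exists (t *: y), 0; split => //.
    by rewrite scalerA mulVf ?gt_eqF// scale1r subr0.
  - by exists 0.
  - move=> [s0 [v [k [Vv Kk ->]]]] [t0 [w [l [Vw Kl ->]]]].
    exists (s + t) => //; split; first exact: addr_ge0.
    have [st0|stN0] := eqVneq (s + t) 0.
      have [s00 t00] : s = 0 /\ t = 0 by split; lra.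
      exists 0, (k + l); split => //; first exact: KD.
      by rewrite st0 s00 t00 !scale0r !sub0r opprD.
    have st_gt0 : 0 < s + t by rewrite lt_neqAle eq_sym stN0 addr_ge0.
    exists ((s / (s + t)) *: v + (t / (s + t)) *: w), (k + l); split.
    + apply: cV => //; [exact: divr_ge0 s0 (ltW _)|exact: divr_ge0 t0 (ltW _)|].
      by rewrite -mulrDl mulfV.
    + exact: KD.
    + rewrite scalerDr !scalerA ![(s + t) * _]mulrC !divfK//.
      by rewrite addrACA -opprD.
  - move=> a0 [s0 [v [k [Vv Kk ->]]]]; exists (a * s) => //.
    split; first exact: mulr_ge0.
    exists v, (a *: k); split => //; first exact: KZ.
    by rewrite scalerBr scalerA.
have [f fle fx] := Hahn_Banach (- x) Sinf.
have finf y t : S y t -> f y <= t.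
  by move=> Syt; apply: le_trans (fle y) _; apply: ge_inf => //; exists 0.
exists f; split.
- suff : 1 <= f (- x) by rewrite linearN; lra.
  rewrite fx; apply: lb_le_inf => [|t [t0 [v [k [Vv Kk xE]]]]].
    have [t t0 tyV] := absV (- x); exists t^-1.
    split; first by rewrite invr_ge0 ltW.
    exists (t *: (- x)), 0; split => //.
    by rewrite scalerA mulVf ?gt_eqF// scale1r subr0.
  rewrite leNgt; apply/negP => t1; apply: (xVK (t *: v)).
    have := cV v 0 t (1 - t); rewrite scaler0 addr0; apply => //; last by ring.
    by rewrite subr_ge0 ltW.
  by rewrite -[x]opprK xE opprB subrK.
- move=> k Kk; rewrite -oppr_le0 -linearN; apply: finf; split => //.
  by exists 0, k; split => //; rewrite scale0r sub0r.
- move=> v Vv; apply: finf; split => //.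
  by exists v, 0; split => //; rewrite scale1r subr0.
Qed.

End Separation.

Section TopologicalSeparation.
Context {R : realType} {E : topologicalLmodType R}.
Implicit Types (K U V : set E) (x y : E).

Lemma translation_continuous x : continuous (fun v : E => x + v).
Proof.
move=> v; apply: (@continuous2_cvg _ E E E (nbhs v) _ (cst x) id +%R x v).
- exact: (@add_continuous E (x, v)).
- exact: cvg_cst.
- exact: cvg_id.
Qed.

Lemma nbhs0_translate x U : nbhs x U -> nbhs (0 : E) [set v | U (x + v)].
Proof.
by move=> xU; have := @translation_continuous x 0; rewrite /continuous_at addr0; apply.
Qed.

Lemma nbhs_translate0 x U : nbhs (0 : E) U -> nbhs x [set y | U (y - x)].
Proof.
move=> xU; have := @translation_continuous (- x) x.
rewrite /continuous_at addNr => /(_ U xU); rewrite nbhs_simpl /=.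
by apply: filterS => y /=; rewrite addrC.
Qed.

Lemma dilation_continuous (a : R) : continuous (fun v : E => a *: v).
Proof.
move=> v; apply: (@continuous2_cvg _ R^o E E (nbhs v) _ (cst a) id *:%R a v).
- exact: (@scale_continuous R E (a, v)).
- exact: cvg_cst.
- exact: cvg_id.
Qed.

Lemma nbhs0_scale (a : R) U : nbhs (0 : E) U -> nbhs (0 : E) [set v | U (a *: v)].
Proof.
by move=> U0; have := @dilation_continuous a 0; rewrite /continuous_at scaler0; apply.
Qed.

Lemma nbhs0_absorbing U y : nbhs (0 : E) U -> exists2 t : R, 0 < t & U (t *: y).
Proof.
move=> U0.
have cy : (fun t : R^o => t *: y) @ (0 : R^o) --> (0 : E).
  rewrite -[X in _ --> X](scale0r y).
  apply: (@continuous2_cvg _ R^o E E (nbhs (0 : R^o)) _ id (cst y) *:%R 0 y).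
  - exact: (@scale_continuous R E (0, y)).
  - exact: cvg_id.
  - exact: cvg_cst.
have /nbhs_ballP[e /= e0 eU] := cy U U0.
exists (e / 2); first by rewrite divr_gt0.
apply: eU; rewrite /ball/= sub0r normrN gtr0_norm ?divr_gt0//.
by rewrite ltr_pdivrMr// mulr_natr mulr2n ltrDl.
Qed.

Lemma scalar_continuousP (f : {scalar E}) :
  (forall e : R, 0 < e -> nbhs (0 : E) [set v | `|f v| < e]) <-> continuous f.
Proof.
split => [f0 x|cf e e0].
  apply/cvgrPdist_lt => e e0; have := nbhs_translate0 x (f0 e e0).
  rewrite near_simpl /prop_near1/=; apply: filterS => y /=.
  by rewrite linearB distrC.
have := cf 0; rewrite /continuous_at linear0 => /cvgrPdist_lt/(_ e e0).
by apply: filterS => v /=; rewrite sub0r normrN.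
Qed.

Lemma scalar_bounded_continuous (f : {scalar E}) V :
  nbhs (0 : E) V -> (forall v, V v -> f v <= 1) -> continuous f.
Proof.
move=> V0 fV; apply/scalar_continuousP => e e0.
have [h h0 he] : exists2 h : R, 0 < h & h < e by exists (e / 2); lra.
apply: filterS (filterI (nbhs0_scale h^-1 V0) (nbhs0_scale (- h^-1) V0)).
move=> v [/fV + /fV]; rewrite scaleNr -scalerN !linearZ/= linearN.
rewrite !(mulrC h^-1) !ler_pdivrMr// !mul1r => fh Nfh.
by apply: le_lt_trans he; rewrite ler_norml fh andbT lerNl.
Qed.

Lemma open_separation K U x : convex_cone K ->
  open U -> @convex_set R E U -> U x -> U `<=` ~` K ->
  exists2 phi, dual_cone K phi & sval phi x < 0.
Proof.
move=> cK oU /convex_setP cU Ux UK.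
have V0 : nbhs (0 : E) [set v | U (x + v)].
  by apply: nbhs0_translate; exact: open_nbhs_nbhs.
have [||||f [fx fK fV]] :=
    @algebraic_separation _ E K [set v | U (x + v)] x cK.
- apply/convex_setP => v w s t s0 t0 st1 /= Uv Uw.
  have := cU _ _ s t s0 t0 st1 Uv Uw.
  by rewrite !scalerDr addrACA -scalerDl st1 scale1r.
- exact: nbhs_singleton V0.
- by move=> y; exact: nbhs0_absorbing.
- by move=> v /UK.
by exists (exist _ f (scalar_bounded_continuous V0 fV)).
Qed.

(** The convex open neighbourhoods of [x] in [E] generate a filter which
converges to [x] along each functional, since preimages of balls under
functionals are convex and open. By the universal property of the weak topology
this filter converges weakly, i.e. contains all weak neighbourhoods. *)
Lemma weak_nbhs_convex x (U : set E) : nbhs (x : weak_topology E) U ->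
  exists V : set E, [/\ open V, @convex_set R E V, V x & V `<=` U].
Proof.
pose B := [set V : set E | [/\ open V, @convex_set R E V & V x]].
pose F := filter_from B id.
have FF : Filter F.
  apply: filter_from_filter => [|V W [oV /convex_setP cV Vx] [oW /convex_setP cW Wx]].
    by exists setT; split => //; exact: openT.
  exists (V `&` W) => //; split => //; first exact: openI.
  apply/convex_setP => y z s t s0 t0 st [Vy Wy] [Vz Wz].
  by split; [exact: cV|exact: cW].
suff Fx : F --> (x : weak_topology E).
  by move=> /Fx [V [oV cV Vx] VU]; exists V.
apply/(@cvg_sup E) => phi W /= [_ [[D oD <-] Dx DW]].
have /nbhs_ballP[e /= e0 eD] : nbhs (sval phi x) D by exact: open_nbhs_nbhs.
exists [set y | `|sval phi x - sval phi y| < e]; last first.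
  by move=> y /= ye; apply: DW; exact: eD.
split.
- have /continuousP := svalP phi.
  by move=> /(_ (ball (sval phi x) e)); apply; exact: ball_open.
- apply/convex_setP => y z s t s0 t0 st /= ye ze.
  rewrite linearD !linearZ/=.
  have -> : sval phi x - (s * sval phi y + t * sval phi z) =
      s * (sval phi x - sval phi y) + t * (sval phi x - sval phi z).
    by rewrite -[X in X - _](mul1r (sval phi x)) -st; ring.
  apply: le_lt_trans (ler_normD _ _) _.
  rewrite !normrM (ger0_norm s0) (ger0_norm t0).
  exact: ltr_convex_combination.
- by rewrite /= subrr normr0.
Qed.

End TopologicalSeparation.

(** * Cones determined by their positive functionals *)

Section DualCone.
Context {R : realType} {E : topologicalLmodType R}.
Implicit Types (K : set E) (x y : E).

(** Equality of [K] with its bidual cone, of which only one inclusion is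
non-trivial. *)
Definition dually_determined K : Prop :=
  forall x, (forall phi, dual_cone K phi -> 0 <= sval phi x) -> K x.

Lemma convex_cone0 K : convex_cone K -> K 0.
Proof. by move=> [[k Kk] _ KZ]; rewrite -(scale0r k); exact: KZ. Qed.

Lemma not_dually_determined K x : dually_determined K -> ~ K x ->
  exists2 phi, dual_cone K phi & sval phi x < 0.
Proof.
move=> detK; apply: contra_notP => nphi; apply: detK => phi Kphi.
by rewrite leNgt; apply/negP => phix; apply: nphi; exists phi.
Qed.

Lemma weakly_closedP K : convex_cone K ->
  weakly_closed K <-> dually_determined K.
Proof.
move=> cK; split => [/closed_openC oK x phix|detK].
  apply: contrapT => Kx.
  have : nbhs (x : weak_topology E) (~` K) by apply: open_nbhs_nbhs.
  move=> /weak_nbhs_convex[V [oV cV Vx VK]].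
  have [phi Kphi] := open_separation cK oV cV Vx VK.
  by rewrite ltNge phix.
rewrite /weakly_closed -[K]setCK; apply: open_closedC; rewrite openE => x Kx.
have [phi Kphi phix] := not_dually_determined detK Kx.
have cphi : nbhs (x : weak_topology E) --> (x : initial_topology (sval phi)).
  exact: (@cvg_sup E _ _ (nbhs (x : weak_topology E)) x _).1 (fun _ => id) phi.
have /cphi phi_x : nbhs (x : initial_topology (sval phi)) [set y | sval phi y < 0].
  apply: open_nbhs_nbhs; split => //.
  by exists [set r | r < 0] => //; exact: (@open_lt R 0).
by apply: (@filterS (weak_topology E) _ _ _ _ _ phi_x) => y /= + Ky; rewrite ltNge Kphi.
Qed.

Lemma semisimple_proper K : convex_cone K -> semisimple_cone K -> proper_cone K.
Proof.
move=> cK ssK; apply/seteqP; split => [x [Kx /= KNx]|_ ->]; last first.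
  by split => /=; rewrite ?oppr0; exact: convex_cone0.
apply: contrapT => /eqP/ssK[phi Kphi]; apply/negP; rewrite negbK.
apply/eqP/le_anti; rewrite Kphi// andbT -oppr_ge0 -linearN; exact: Kphi.
Qed.

Lemma proper_semisimple K : dually_determined K -> proper_cone K ->
  semisimple_cone K.
Proof.
move=> detK /seteqP[pK _] x x0; apply: contrapT => nphi.
have phi0 phi : dual_cone K phi -> sval phi x = 0.
  by move=> Kphi; apply: contrapT => /eqP phix; apply: nphi; exists phi.
move/eqP: x0; apply; apply: pK; split; apply: detK => phi Kphi.
  by rewrite phi0.
by rewrite linearN phi0// oppr0.
Qed.

End DualCone.

(** * Topologies generated by seminorms *)

(** A copy of [E] that carries the topology generated by the family [p]. *)
Definition seminorm_topology {R : realType} {E : lmodType R} {I : eqType}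
  (p : I -> E -> R) : Type := E.

Section SeminormTopology.
Context {R : realType} {E : lmodType R} {I : eqType} (p : I -> E -> R).
Local Notation F := (seminorm_topology p).
Implicit Types (s : seq I) (x y : E) (e : R) (U : set E).

Definition multiball x s e : set E := [set y | all (fun i => p i (y - x) < e) s].

Let op U := forall x, U x -> exists s, exists2 e, 0 < e & multiball x s e `<=` U.

Lemma multiball_cat x s s' e e' :
  multiball x (s ++ s') (Num.min e e') `<=` multiball x s e `&` multiball x s' e'.
Proof.
move=> y; rewrite /multiball /= all_cat => /andP[ys ys']; split.
  by apply: sub_all ys => i; rewrite lt_min => /andP[].
by apply: sub_all ys' => i; rewrite lt_min => /andP[].
Qed.

Let opT : op setT.
Proof. by move=> x _; exists [::]; exists 1. Qed.

Let opI : setI_closed op.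
Proof.
move=> U V oU oV x [/oU[s [e e0 sU]] /oV[s' [e' e'0 sV]]].
exists (s ++ s'); exists (Num.min e e'); first by rewrite lt_min e0.
by apply: subset_trans (@multiball_cat _ _ _ _ _) _; apply: setISS.
Qed.

Let op_bigU (J : Type) (f : J -> set E) :
  (forall j, op (f j)) -> op (\bigcup_j f j).
Proof.
move=> of_ x [j _ /of_[s [e e0 sU]]]; exists s; exists e => // y /sU fy.
by exists j.
Qed.

HB.instance Definition _ := Choice.on F.
HB.instance Definition _ :=
  isOpenTopological.Build F opT opI op_bigU.

Lemma seminorm_openE U : @open F U =
  (forall x, U x -> exists s, exists2 e, 0 < e & multiball x s e `<=` U).
Proof. by []. Qed.

Hypothesis pD : forall i x y, p i (x + y) <= p i x + p i y.
Hypothesis pZ : forall i (a : R) x, p i (a *: x) = `|a| * p i x.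

Let p0 i : p i 0 = 0.
Proof. by have := pZ i 0 0; rewrite scale0r normr0 mul0r. Qed.

Let pC i x y : p i (x - y) = p i (y - x).
Proof. by rewrite -[x - y]opprB -[- (y - x)]scaleN1r pZ normrN1 mul1r. Qed.


Lemma multiball_center x s e : 0 < e -> multiball x s e x.
Proof. by move=> e0; apply/allP => i _; rewrite subrr p0. Qed.

(** The radius left around [y] is the least of the gaps [e - p i (y - x)] over
the finitely many indices [i] of [s]. *)
Lemma multiball_open x s e : @open F (multiball x s e).
Proof.
move=> y ye; exists s.
suff [d d0 dP] : exists2 d : R, 0 < d & all (fun i => p i (y - x) + d <= e) s.
  exists d => // z zd; apply/allP => i si.
  have /= := allP dP i si; have /= := allP zd i si.
  have := pD i (z - y) (y - x); rewrite addrA subrK; lra.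
elim: s ye => [_|i s IHs /=]; first by exists 1.
move=> /andP[ie /IHs[d d0 dP]]; exists (Num.min d (e - p i (y - x))).
  by rewrite lt_min d0 subr_gt0.
apply/andP; split; first by rewrite -lerBrDl ge_min lexx orbT.
apply: sub_all dP => j; apply: le_trans; rewrite lerD2l.
by rewrite ge_min lexx.
Qed.

Lemma seminorm_nbhsP x U :
  nbhs (x : F) U <-> exists s, exists2 e, 0 < e & multiball x s e `<=` U.
Proof.
rewrite (@nbhsE F); split => [[V [oV Vx] VU]|[s [e e0 sU]]].
  have [s [e e0 sV]] := oV x Vx.
  by exists s; exists e => //; exact: subset_trans VU.
exists (multiball x s e) => //; split; first exact: multiball_open.
exact: multiball_center.
Qed.

Lemma multiball_nbhs x s e : 0 < e -> nbhs (x : F) (multiball x s e).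
Proof. by move=> e0; apply/seminorm_nbhsP; exists s; exists e. Qed.

Lemma seminorm_add_continuous :
  continuous ((fun z => (z.1 : E) + (z.2 : E)) : F * F -> F).
Proof.
move=> [x y] U /seminorm_nbhsP[s [e e0 sU]].
exists (multiball x s (e / 2), multiball y s (e / 2)).
  by split; apply: multiball_nbhs; rewrite divr_gt0.
move=> [x' y'] [/= xs ys]; apply: sU; apply/allP => i si /=.
rewrite opprD addrACA; apply: le_lt_trans (pD _ _ _) _.
by rewrite [ltRHS]splitr; apply: ltrD; [have := allP xs i si|have := allP ys i si].
Qed.

Lemma seminorm_scale_continuous :
  continuous ((fun z => z.1 *: (z.2 : E)) : R * F -> F).
Proof.
move=> [a y] U /seminorm_nbhsP[s [e e0 sU]].
have p_ge0 i x : 0 <= p i x.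
  by have := pD i x (- x); rewrite subrr p0 -[- x]scaleN1r pZ normrN1 mul1r; lra.
(* [b *: z - a *: y = b *: (z - y) + (b - a) *: y]: the first term is controlled
   by [`|b| <= `|a| + 1], the second by a bound [M] of the [p i y]. *)
have [M M0 yM] : exists2 M : R, 0 < M & all (fun i => p i y <= M) s.
  elim: s {sU} => [|i s [M M0 yM]]; first by exists 1.
  exists (M + p i y); first by rewrite ltr_wpDr.
  rewrite /= lerDr ltW//=; apply: sub_all yM => j jM.
  by apply: le_trans jM _; rewrite lerDl.
pose d := Num.min 1 (e / 2 / M).
have d0 : 0 < d by rewrite lt_min ltr01 !divr_gt0.
have a1 : 0 < `|a| + 1 by rewrite ltr_wpDl.
exists (ball a d, multiball y s (e / 2 / (`|a| + 1))).
  split; first exact: nbhsx_ballx.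
  by apply: multiball_nbhs; rewrite !divr_gt0.
move=> [b z] [/= ab zs]; apply: sU; apply/allP => i si /=.
move: ab; rewrite /ball/= distrC lt_min => /andP[ba1 baM].
have -> : b *: z - a *: y = b *: (z - y) + (b - a) *: y.
  by rewrite scalerBr scalerBl addrA subrK.
apply: le_lt_trans (pD _ _ _) _; rewrite !pZ [ltRHS]splitr; apply: ltr_leD.
  have ba : `|b| <= `|a| + 1.
    by have := ler_normD (b - a) a; rewrite subrK; lra.
  have := allP zs i si; rewrite /= ltr_pdivlMr// mulrC; apply: le_lt_trans.
  by apply: ler_wpM2r.
move: baM; rewrite ltr_pdivlMr// => /ltW; apply: le_trans.
by apply: ler_wpM2l => //; exact: (allP yM).
Qed.

Lemma multiball_convex x s e : @convex_set R E (multiball x s e).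
Proof.
apply/convex_setP => y z a b a0 b0 ab ys zs; apply/allP => i si /=.
have -> : a *: y + b *: z - x = a *: (y - x) + b *: (z - x).
  by rewrite !scalerBr addrACA -opprD -scalerDl ab scale1r.
apply: le_lt_trans (pD _ _ _) _; rewrite !pZ !ger0_norm//.
exact: ltr_convex_combination (allP ys i si) (allP zs i si).
Qed.

Lemma seminorm_locally_convex : (forall x, x != 0 -> exists i, p i x != 0) ->
  locally_convex_topology (Topological.class F).
Proof.
move=> psep; split.
- move=> x y clxy; apply: contrapT => /eqP; rewrite -subr_eq0 => /psep[i pxy].
  have d0 : 0 < p i (x - y) / 2.
    rewrite divr_gt0// lt_neqAle eq_sym pxy.
    by have := pD i (x - y) (y - x); rewrite addrA subrK subrr p0 (pC i y); lra.
  have [z [/= zx zy]] := clxy _ _ (multiball_nbhs x [:: i] d0)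
    (multiball_nbhs y [:: i] d0).
  move: zx zy; rewrite /multiball /= !andbT (pC i z x).
  have := pD i (x - z) (z - y); rewrite addrA subrK; lra.
- exact: seminorm_add_continuous.
- exact: seminorm_scale_continuous.
- exists [set U | exists x s e, U = multiball x s e].
    by move=> _ [x [s [e ->]]]; exact: multiball_convex.
  split => [_ [x [s [e ->]]]|x U /seminorm_nbhsP[s [e e0 sU]]].
    exact: multiball_open.
  exists (multiball x s e) => //; split; first by exists x, s, e.
  exact: multiball_center.
Qed.

(** The hypothesis makes every ball around [0] full. It is stronger than
monotonicity on the cone, and is satisfied by absolute values of positive
functionals and by suprema of these. *)
Lemma seminorm_normal (K : set E) :
  (forall i x y z, cone_le K x y -> cone_le K y z ->
     p i y <= Num.max (p i x) (p i z)) ->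
  normal_for (Topological.class F) K.
Proof.
move=> pK U /seminorm_nbhsP[s [e e0 sU]]; exists (multiball 0 s e); split => //.
  exact: multiball_nbhs.
move=> x y z xs zs xy yz; apply/allP => i si /=; rewrite subr0.
apply: le_lt_trans (pK i x y z xy yz) _.
have /= := allP xs i si; have /= := allP zs i si.
by rewrite !subr0 gt_max => -> ->.
Qed.

End SeminormTopology.

Section WeakerSeminormTopology.
Context {R : realType} {E : topologicalLmodType R} {I : eqType}.
Variable p : I -> E -> R.
Hypothesis pD : forall i x y, p i (x + y) <= p i x + p i y.
Hypothesis pZ : forall i (a : R) x, p i (a *: x) = `|a| * p i x.

Lemma seminorm_topology_weaker :
  (forall i e, 0 < e -> nbhs (0 : E) [set v | p i v < e]) ->
  weaker_topology (Topological.class (seminorm_topology p)) (Topological.class E).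
Proof.
move=> p0 U oU; change (open (U : set E)); rewrite openE => x Ux.
have [s [e e0 sU]] := oU x Ux.
apply: filterS sU _.
suff : nbhs (0 : E) [set v | all (fun i => p i v < e) s].
  by move=> /(nbhs_translate0 x).
elim: s => [|i s IHs]; first by apply: filterS filterT => v _.
by apply: filterS (filterI (p0 i e e0) IHs) => v /= [-> ->].
Qed.

(** Closedness is the only place where the seminorms are compared with the
positive functionals: a functional that is negative at a point outside [K]
stays so on a small ball around this point. *)
Lemma weaker_normal_seminorm_topology (K : set E) :
  dually_determined K ->
  (forall i e, 0 < e -> nbhs (0 : E) [set v | p i v < e]) ->
  (forall x, x != 0 -> exists i, p i x != 0) ->
  (forall i x y z, cone_le K x y -> cone_le K y z ->
     p i y <= Num.max (p i x) (p i z)) ->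
  (forall phi, dual_cone K phi ->
     exists i, exists2 C : R, 0 < C & forall x, `|sval phi x| <= C * p i x) ->
  weaker_normal_topology K (Topological.class (seminorm_topology p)).
Proof.
move=> detK p0 psep pK phip; split.
- exact: seminorm_topology_weaker.
- exact: seminorm_locally_convex.
- rewrite /closed_for -[K]setCK; apply: open_closedC.
  rewrite seminorm_openE => x Kx.
  have [phi Kphi phix] := not_dually_determined detK Kx.
  have [i [C C0 phiC]] := phip phi Kphi.
  exists [:: i]; exists (- sval phi x / C); first by rewrite divr_gt0// oppr_gt0.
  move=> y; rewrite /multiball /= andbT => yx Ky.
  have := Kphi y Ky; rewrite leNgt => /negP; apply.
  have := phiC (y - x); rewrite linearB/= => /(le_trans (ler_norm _)).
  by move: yx; rewrite ltr_pdivlMr// mulrC; lra.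
- exact: seminorm_normal.
Qed.

End WeakerSeminormTopology.

Section WeakNormalTopology.
Context {R : realType} {E : topologicalLmodType R}.

(** The topology of pointwise convergence on the positive functionals, which is
in general strictly weaker than the weak topology. *)
Lemma weak_normal_topology (K : set E) :
  dually_determined K -> semisimple_cone K ->
  exists T : Topological E, weaker_normal_topology K T.
Proof.
move=> detK ssK.
pose I : Type := {classic set_type (dual_cone K)}.
pose ev (w : I) : {scalar E} := sval (set_val (w : set_type (dual_cone K))).
pose p (w : I) (x : E) : R := `|ev w x|.
have pE phi : dual_cone K phi -> exists w, forall x, p w x = `|sval phi x|.
  by move=> Kphi; exists (SigSub (mem_set Kphi)).
exists (Topological.class (seminorm_topology p)).
apply: weaker_normal_seminorm_topology => //.
- by move=> w x y; rewrite /p linearD ler_normD.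
- by move=> w a x; rewrite /p linearZ normrM.
- move=> w e e0; have /scalar_continuousP := svalP (set_val (w : set_type (dual_cone K))).
  exact.
- move=> x /ssK[phi /pE[w wE] phix]; exists w.
  by rewrite wE normr_eq0.
- move=> w x y z xy yz; rewrite /p.
  have Kw v : K v -> 0 <= ev w v by exact: (set_valP (w : set_type (dual_cone K))).
  have := Kw _ xy; have := Kw _ yz; rewrite !linearB/= !subr_ge0.
  by move=> wyz wxy; exact: ler_norm_between.
- move=> phi /pE[w wE]; exists w; exists 1 => // x.
  by rewrite mul1r wE.
Qed.

(** A convex open set of [T] is open in [E], so the separation takes place in
[E] and directly yields a functional continuous on [E]. *)
Lemma normal_topology_determined (K : set E) (T : Topological E) :
  convex_cone K -> weaker_normal_topology K T ->
  dually_determined K /\ semisimple_cone K.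
Proof.
move=> cK [TE [hausT _ _ [B cB [oB bB]]] clK nK].
have detK : dually_determined K.
  move=> x phix; apply: contrapT => Kx.
  have oKC : @open (Topological.Pack T) (~` K) by exact: closed_openC.
  have /bB[U [BU Ux] UK] : @nbhs _ (Topological.Pack T) x (~` K).
    exact: open_nbhs_nbhs.
  have [phi Kphi] := open_separation cK (TE _ (oB _ BU)) (cB _ BU) Ux UK.
  by rewrite ltNge phix.
split => //; apply: proper_semisimple => //.
apply/seteqP; split => [x [Kx /= KNx]|_ ->]; last first.
  by split => /=; rewrite ?oppr0; exact: convex_cone0.
apply/esym/hausT => U V U0 Vx.
have [W [W0 WU Wfull]] := nK U U0; exists x; split; last exact: nbhs_singleton Vx.
by apply/WU/(Wfull 0 x 0); rewrite /cone_le ?subr0 ?sub0r//; exact: nbhs_singleton W0.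
Qed.

End WeakNormalTopology.

(** * Representations by continuous functions *)

Section EvaluationRepresentation.
Context {R : realType} {E : topologicalLmodType R} {Omega : topologicalType}.
Implicit Types (K : set E) (x : E) (w : Omega).

(** The evaluation map [x |-> (w |-> ev w x)] is a representation as soon as
the functionals indexed by a compact set are equicontinuous. *)
Lemma Ck_representation_of_functionals K (ev : Omega -> {scalar E}) :
  (forall x, continuous (fun w => ev w x : R)) ->
  (forall A, compact A -> forall e : R, 0 < e ->
     nbhs (0 : E) [set v | forall w, A w -> `|ev w v| < e]) ->
  (forall x, (forall w, ev w x = 0) -> x = 0) ->
  (forall x, K x <-> forall w, 0 <= ev w x) ->
  has_Ck_representation K Omega.
Proof.
move=> cev equi sep bipos.
pose f (x : E) : Ck Omega R := mkcts (cev x).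
have lf : linear f.
  by move=> a x y; apply/continuousEP => w; exact: (linearP (ev w) a x y).
pose lf' := GRing.isLinear.Build R E (Ck Omega R) *:%R f lf.
pose T : {linear E -> Ck Omega R} := HB.pack f lf'.
exists T; split.
- apply: continuous_comp_initial => x; apply/fam_cvgP => A cA U /uniform_nbhs.
  move=> [V [/=]]; rewrite -entourage_ballE => -[e /= e0 eV] VU.
  have := nbhs_translate0 x (equi A cA e e0).
  apply: filterS => y yx; apply: VU => w Aw; apply: eV.
  by rewrite /ball/= distrC; have := yx w Aw; rewrite linearB.
- move=> x y /(congr1 (fun g : Ck Omega R => g : Omega -> R)) xy.
  apply/eqP; rewrite -subr_eq0; apply/eqP/sep => w.
  by rewrite linearB/=; apply/eqP; rewrite subr_eq0; apply/eqP; have := congr1 (@^~ w) xy.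
- by apply/seteqP; split => x; rewrite /Cnonneg /=; apply bipos.
Qed.

Lemma Ck_Cp_representation K :
  has_Ck_representation K Omega -> has_Cp_representation K Omega.
Proof.
move=> [T [cT iT bT]].
pose lf' := GRing.isLinear.Build R E (Cp Omega R) *:%R T (fun a => linearP T a).
pose T' : {linear E -> Cp Omega R} := HB.pack (T : E -> Cp Omega R) lf'.
exists T'; split => //.
apply: continuous_comp_initial => x.
apply: pointwise_cvg_compact_family.
have := @initial_continuous (Ck Omega R) {family compact, Omega -> R} (fun f => f) (T x).
exact: continuous_comp (cT x).
Qed.

Lemma Cp_representation_functional (T : {linear E -> Cp Omega R}) w :
  continuous T -> exists phi : dual E, forall x, sval phi x = T x w.
Proof.
move=> cT.
have lf : linear_for *%R (fun x => T x w) by move=> a x y; rewrite linearP.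
suff cphi : continuous (scalar_of lf) by exists (exist _ (scalar_of lf) cphi).
move=> x; apply: (@continuous_comp _ {ptws Omega -> R} _ (fun x => (T x : Omega -> R))
   (fun f => f w)); last exact: (@proj_continuous Omega (fun=> R) w).
apply: (continuous_comp (cT x)).
exact: (@initial_continuous (continuousType Omega R) {ptws Omega -> R}).
Qed.

Lemma Cp_representation_determined K : has_Cp_representation K Omega ->
  dually_determined K /\ semisimple_cone K.
Proof.
move=> [T [cT iT KT]]; split => [x phix|x x0].
  rewrite KT => w; have [phi phiE] := Cp_representation_functional w cT.
  by rewrite -phiE; apply: phix => y; rewrite phiE KT; apply.
have [w Tw] : exists w, T x w != 0.
  apply: contra_notP (elimN eqP x0) => nw; apply: iT; apply/continuousEP => w.
  rewrite linear0; apply: contrapT => Tw; apply: nw; exists w; exact/eqP.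
have [phi phiE] := Cp_representation_functional w cT.
by exists phi; [move=> y; rewrite phiE KT; apply|rewrite phiE].
Qed.

End EvaluationRepresentation.

Section DiscreteRepresentation.
Context {R : realType} {E : topologicalLmodType R}.

(** For an infinite compact [A], the filter of sets cofinite in [A] would have a
cluster point, but it contains the complement of every point. *)
Lemma discrete_compact_finite (X : discreteTopologicalType) (A : set X) :
  compact A -> finite_set A.
Proof.
move=> cA; apply: contrapT => infA.
pose F : set_system X := [set B | finite_set (A `\` B)].
have FF : ProperFilter F.
  split; first by rewrite /F /= setD0.
  split => [|B C FB FC|B C BC]; rewrite /F /= ?setDT//.
    by rewrite setDIr finite_setU.
  by apply: sub_finite_set => x [Ax Cx]; split => // /BC.
have [|x [Ax clx]] := cA F FF; first by rewrite /F /= setDv.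
have Fx : F (~` [set x]) by apply: sub_finite_set (finite_set1 x) => y [_ /contrapT].
by have [y [+ yx]] := clx _ _ Fx (discrete_set1 x).
Qed.

Lemma discrete_representation (K : set E) :
  dually_determined K -> semisimple_cone K ->
  exists Omega : topologicalType,
    [/\ locally_compact [set: Omega], hausdorff_space Omega
      & has_Ck_representation K Omega].
Proof.
move=> detK ssK.
pose Omega := discrete_topology {classic set_type (dual_cone K)}.
exists Omega; split.
- move=> w _; exists [set w]; last first.
    by split; [exact: compact_set1|exact: discrete_closed].
  by apply: (@filterS Omega (nbhs w) _ _ _ _ (discrete_set1 w)) => y -> _.
- exact: discrete_hausdorff.
- pose ev (w : Omega) : {scalar E} := sval (set_val (w : set_type (dual_cone K))).
  have evP phi : dual_cone K phi -> exists w, ev w = sval phi.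
    by move=> Kphi; exists (SigSub (mem_set Kphi)).
  apply: (@Ck_representation_of_functionals _ _ _ _ ev).
  + by move=> x; apply/continuousP => B _; exact: discrete_open.
  + move=> A /discrete_compact_finite/finite_fsetP[D ->] e e0.
    apply: (@filter_bigI E Omega D (fun w => [set v | `|ev w v| < e]) (nbhs (0 : E)) _).
    move=> w _; have /scalar_continuousP := svalP (set_val (w : set_type (dual_cone K))).
    exact.
  + move=> x evx; apply: contrapT => /eqP/ssK[phi /evP[w <-]].
    by rewrite evx eqxx.
  + move=> x; split => [Kx w|evx]; last first.
      by apply: detK => phi /evP[w <-].
    by apply: (set_valP (w : set_type (dual_cone K))).
Qed.

End DiscreteRepresentation.

(** * The normed case *)

Section SubspaceTopology.
Context {X : topologicalType} (A : set X).

Lemma compact_set_type : compact A -> compact [set: set_type A].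
Proof.
move=> cA F FF _.
have [|x [Ax clx]] := cA (set_val @ F) _.
  by apply: (@filterE _ F _) => w; exact: set_valP.
exists (SigSub (mem_set Ax)); split => // B U FB [_ [[V oV <-] Vx VU]].
have [|_ [[w Bw <-] Vw]] := clx (set_val @` B) V _ (open_nbhs_nbhs (conj oV Vx)).
  by apply: (@filterS _ F _ _ _ _ FB) => w Bw; exists w.
by exists w; split => //; exact: VU.
Qed.

Lemma hausdorff_set_type : hausdorff_space X -> hausdorff_space (set_type A).
Proof.
move=> hX v w clvw; apply: val_inj; apply: hX => U V Uv Vw.
have cval := @initial_continuous (set_type A) X set_val.
by have [u [Uu Vu]] := clvw _ _ (cval v U Uv) (cval w V Vw); exists (set_val u).
Qed.

End SubspaceTopology.

Lemma closed_linear_relation {R : realType} {X : topologicalType} (a : R) (u v w : X -> R) :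
  continuous u -> continuous v -> continuous w ->
  closed [set f | u f = a * v f + w f].
Proof.
move=> cu cv cw.
have -> : [set f | u f = a * v f + w f] =
    (fun f => u f - (a * v f + w f)) @^-1` [set r | r = 0].
  by apply/seteqP; split => f /= /eqP; rewrite ?subr_eq0 => /eqP // ->; rewrite subrr.
apply: closed_comp => [f _|]; last exact: (@closed_eq R 0).
apply: cvgB; first exact: cu.
by apply: cvgD; [apply: cvgM; [exact: cvg_cst|exact: cv]|exact: cw].
Qed.

Section NormedCase.
Context {R : realType} {E : normedModType R} (K : set E).
Hypothesis detK : dually_determined K.
Hypothesis ssK : semisimple_cone K.

(** The positive part of the unit ball of the dual, as a set of functions on
[E] rather than of bundled functionals, so that it inherits the topology of
pointwise convergence. Continuity follows from the norm bound. *)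
Definition positive_dual_ball : set {ptws E -> R} :=
  [set f | [/\ linear_for *%R (f : E -> R), forall x, `|f x| <= `|x| &
    forall x, K x -> 0 <= f x]].
Local Notation A := positive_dual_ball.

Lemma positive_dual_ball0 : A (fun=> 0).
Proof.
split => // [a x y|x]; first by rewrite mulr0 addr0.
by rewrite normr0.
Qed.

Lemma closed_positive_dual_ball : closed A.
Proof.
have proj x : continuous (fun f : {ptws E -> R} => f x : R).
  exact: (@proj_continuous E (fun=> R) x).
have -> : A = \bigcap_(i : R * E * E)
      [set f : {ptws E -> R} | f (i.1.1 *: i.1.2 + i.2) = i.1.1 * f i.1.2 + f i.2]
    `&` \bigcap_(x : E) [set f : {ptws E -> R} | `|f x| <= `|x|]
    `&` \bigcap_(x in K) [set f : {ptws E -> R} | 0 <= f x].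
  apply/seteqP; split => [f [lf fx fK]|f [[lf fx] fK]].
    split; last by move=> x Kx; exact: fK.
    by split => [[[a x] y] _ /=|x _]; [exact: lf|exact: fx].
  split => [a x y|x|x Kx]; [|exact: fx|exact: fK].
  exact: (lf (a, x, y)).
apply: closedI; first apply: closedI.
- apply: closed_bigI => -[[a x] y] _ /=.
  exact: (@closed_linear_relation R {ptws E -> R} a _ _ _ (proj _) (proj _) (proj _)).
- apply: closed_bigI => x _.
  have -> : [set f : {ptws E -> R} | `|f x| <= `|x|] =
      (fun f : {ptws E -> R} => f x) @^-1` `[- `|x|, `|x|]%classic.
    by apply/seteqP; split => f /=; rewrite in_itv/= ler_norml.
  apply: closed_comp; last exact: interval_closed.
  by move=> f _; exact: proj.
- apply: closed_bigI => x _.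
  apply: (@closed_comp _ _ (fun f : {ptws E -> R} => f x) [set r | 0 <= r]).
    by move=> f _; exact: proj.
  exact: closed_ge.
Qed.

(** Alaoglu: a closed subset of the product of the segments
[[- `|x|, `|x|]]. *)
Lemma compact_positive_dual_ball : compact A.
Proof.
apply: (@subclosed_compact _ A
  [set f : {ptws E -> R} | forall x, `[- `|x|, `|x|]%classic (f x)]).
- exact: closed_positive_dual_ball.
- apply: (@tychonoff E (fun=> R) (fun x => `[- `|x|, `|x|]%classic)) => x.
  exact: segment_compact.
- by move=> f [_ fx _] x /=; rewrite in_itv/= -ler_norml.
Qed.

Lemma positive_dual_ball_scaled phi : dual_cone K phi ->
  exists2 C : R, 0 < C & exists2 f, A f & forall x, sval phi x = C * f x.
Proof.
move=> Kphi.
have [C C0 phiC] : exists2 C : R, 0 < C & forall x, `|sval phi x| <= C * `|x|.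
  have /linear_boundedP bphi :=
    @continuous_linear_bounded R E R^o 0 (sval phi) (svalP phi 0).
  near (+oo_R : set_system R) => C.
  by exists C; [near: C; exact: nbhs_pinfty_gt|near: C].
exists C => //; exists (fun x => C^-1 * sval phi x).
  split => [a x y|x|x Kx].
  - by rewrite linearP/=; ring.
  - by rewrite normrM gtr0_norm ?invr_gt0// ler_pdivrMl.
  - by apply: mulr_ge0; [rewrite invr_ge0 ltW|exact: Kphi].
by move=> x; rewrite mulrA mulfV ?gt_eqF// mul1r.
Unshelve. all: by end_near. Qed.

Lemma positive_dual_ball_separates x : x != 0 -> exists2 f, A f & f x != 0.
Proof.
move=> /ssK[phi /positive_dual_ball_scaled[C C0 [f Af phiE]]].
by rewrite phiE mulf_eq0 negb_or => /andP[_ fx]; exists f.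
Qed.

Lemma positive_dual_ball_determines x : K x <-> forall f, A f -> 0 <= f x.
Proof.
split => [Kx f [_ _]|fx]; first exact.
apply: detK => phi /positive_dual_ball_scaled[C C0 [f Af ->]].
by apply: mulr_ge0; [exact: ltW|exact: fx].
Qed.

Lemma compact_representation :
  exists Omega : topologicalType,
    [/\ compact [set: Omega], hausdorff_space Omega & has_Ck_representation K Omega].
Proof.
exists (set_type A); split.
- exact/compact_set_type/compact_positive_dual_ball.
- apply: hausdorff_set_type; apply: (@hausdorff_product E (fun=> R)) => x.
  exact: Rhausdorff.
- have lw (w : set_type A) : linear_for *%R (set_val w : E -> R).
    by have [] := set_valP w.
  apply: (@Ck_representation_of_functionals _ _ _ _ (fun w => scalar_of (lw w))).
  + move=> x w; apply: (@continuous_comp _ {ptws E -> R} _ set_val (fun f => f x)).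
      exact: (@initial_continuous (set_type A) {ptws E -> R} set_val w).
    exact: (@proj_continuous E (fun=> R) x).
  + move=> B _ e e0; apply: filterS (nbhsx_ballx (0 : E) e e0) => v.
    rewrite -ball_normE /= sub0r normrN => ve w _; have [_ wv _] := set_valP w.
    exact: le_lt_trans (wv v) ve.
  + move=> x wx; apply: contrapT => /eqP/positive_dual_ball_separates[f Af].
    by move=> /eqP; apply; exact: (wx (SigSub (mem_set Af))).
  + move=> x; rewrite positive_dual_ball_determines; split => [fx w|wx f Af].
      exact/fx/set_valP.
    exact: (wx (SigSub (mem_set Af))).
Qed.

(** The norm of [x] as a function on the positive part of the dual ball; it is
at most [`|x|], and in general not equivalent to it. *)
Definition positive_dual_norm (x : E) : R := sup [set `|f x| | f in A].
Local Notation N := positive_dual_norm.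

Lemma le_positive_dual_norm f x : A f -> `|f x| <= N x.
Proof.
move=> Af; apply: ub_le_sup; last by exists f.
by exists `|x| => _ [g [_ gx _] <-].
Qed.

Lemma positive_dual_norm_le x M : (forall f, A f -> `|f x| <= M) -> N x <= M.
Proof.
move=> fM; apply: ge_sup => [|_ [f /fM fxM <-]//].
by exists `|0 : R|; exists (fun=> 0) => //; exact: positive_dual_ball0.
Qed.

Lemma positive_dual_norm_is_norm : is_norm N.
Proof.
have NZ (a : R) x : N (a *: x) <= `|a| * N x.
  apply: positive_dual_norm_le => f Af; have [lf _ _] := Af.
  have -> : f (a *: x) = a * f x.
    have f0 : f 0 = 0 by have := lf 1 0 0; rewrite scale1r mul1r addr0; lra.
    by have := lf a x 0; rewrite addr0 f0 addr0.
  by rewrite normrM; apply: ler_wpM2l => //; exact: le_positive_dual_norm.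
split => [x Nx|x y|a x].
- apply: contrapT => /eqP/positive_dual_ball_separates[f Af].
  by rewrite -normr_le0 -Nx le_positive_dual_norm.
- apply: positive_dual_norm_le => f Af; have [lf _ _] := Af.
  have := lf 1 x y; rewrite scale1r mul1r => ->.
  by apply: le_trans (ler_normD _ _) _; apply: lerD; exact: le_positive_dual_norm.
- apply/le_anti; rewrite NZ /=; have [->|a0] := eqVneq a 0.
    have N0 : 0 <= N (0 *: x).
      exact: le_trans (normr_ge0 _) (le_positive_dual_norm _ positive_dual_ball0).
    by rewrite normr0 mul0r.
  have := NZ a^-1 (a *: x); rewrite scalerA mulVf// scale1r normfV.
  by rewrite ler_pdivlMl ?normr_gt0.
Qed.

Lemma normable_normal_topology :
  exists2 T : Topological E, weaker_normal_topology K T & normable_topology T.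
Proof.
have [N0 ND NZ] := positive_dual_norm_is_norm.
pose p (_ : unit) := N.
exists (Topological.class (seminorm_topology p)).
  apply: weaker_normal_seminorm_topology => //.
  - move=> [] e e0; apply: filterS (nbhsx_ballx (0 : E) e e0) => v.
    rewrite -ball_normE /= sub0r normrN; apply: le_lt_trans.
    by apply: positive_dual_norm_le => f [_ fx _]; exact: fx.
  - by move=> x x0; exists tt; apply: contra x0 => /eqP/N0 ->.
  - move=> [] x y z xy yz; apply: positive_dual_norm_le => f Af.
    have fx := positive_dual_ball_determines.
    have fB u v : f (v - u) = f v - f u.
      have [lf _ _] := Af; have := lf (-1) u v; rewrite scaleN1r mulN1r => fuv.
      by rewrite addrC fuv addrC.
    have := (fx _).1 xy f Af; have := (fx _).1 yz f Af; rewrite !fB.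
    rewrite !subr_ge0 => fyz fxy; apply: le_trans (ler_norm_between fxy fyz) _.
    by rewrite ge_max !le_max !le_positive_dual_norm ?orbT.
  - move=> phi /positive_dual_ball_scaled[C C0 [f Af phiE]].
    exists tt; exists C => // x; rewrite phiE normrM gtr0_norm//.
    by rewrite ler_pM2l// le_positive_dual_norm.
exists N => // x U; rewrite seminorm_nbhsP//; split => [[s [e e0 sU]]|[e e0 eU]].
  by exists e => // y ye; apply: sU; apply/allP.
by exists [:: tt]; exists e => // y; rewrite /multiball /= andbT => /eU.
Qed.

End NormedCase.

(** * The equivalence *)

Theorem theorem5p1 (R : realType) :
  (forall (E : topologicalLmodType R) (K : set E),
     hausdorff_space E -> convex_cone K ->
     [<-> weakly_closed K /\ semisimple_cone K;
          weakly_closed K /\ proper_cone K;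
          exists T : Topological E, weaker_normal_topology K T;
          exists Omega : topologicalType, has_Cp_representation K Omega;
          exists Omega : topologicalType,
            [/\ locally_compact [set: Omega], hausdorff_space Omega
              & has_Ck_representation K Omega]])
  /\
  (forall (E : normedModType R) (K : set E),
     convex_cone K -> weakly_closed K /\ semisimple_cone K ->
     (exists2 T : Topological E, weaker_normal_topology K T
        & normable_topology T)
     /\
     (exists Omega : topologicalType,
        [/\ compact [set: Omega], hausdorff_space Omega
          & has_Ck_representation K Omega])).
Proof.
split => [E K _ cK|E K cK [/(weakly_closedP cK) detK ssK]]; last first.
  by split; [exact: normable_normal_topology|exact: compact_representation].
have wcP := weakly_closedP cK.
tfae.
- by move=> [wcK ssK]; split => //; exact: semisimple_proper.
- move=> [/wcP detK pK]; apply: weak_normal_topology => //.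
  exact: proper_semisimple.
- move=> [T /(normal_topology_determined cK)[detK ssK]].
  have [X [_ _ CkK]] := discrete_representation detK ssK.
  by exists X; exact: Ck_Cp_representation.
- by move=> [X /Cp_representation_determined[]]; exact: discrete_representation.
- move=> [X [_ _ /Ck_Cp_representation/Cp_representation_determined[detK ssK]]].
  by split => //; exact/wcP.
Qed.
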